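(* For $\lambda>0$, let $X_\lambda$ denote an exponential random variable with parameter $\lambda$. Then for every real $y>0$, $$\inf_{\lambda>0}\mathbf{P}\left(|X_\lambda-\mathbf{E}[X_\lambda]|\ge y\sqrt{\mathrm{Var}(X_\lambda)}\right)=\begin{cases}1-e^{-(1-y)}+e^{-(1+y)}, & \text{if } 0<y<1,\\ e^{-(1+y)}, & \text{if } y\ge 1.\end{cases}$$
   Context: $\mathbf{P}$, $\mathbf{E}$ and $\mathrm{Var}$ denote probability, expectation and variance. The exponential distribution with parameter $\lambda>0$ is the one with probability density function $\lambda e^{-\lambda x}$ for $x>0$ (so its mean is $1/\lambda$ and its variance is $1/\lambda^2$). *)

(* Defs.v *)
From HB Require Import structures.
From mathcomp Require Import all_boot all_order all_algebra.
From mathcomp Require Import all_classical all_reals all_analysis.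

Set Implicit Arguments.
Unset Strict Implicit.
Unset Printing Implicit Defensive.

Import Order.TTheory GRing.Theory Num.Theory.
Import numFieldNormedType.Exports.

Local Open Scope classical_set_scope.
Local Open Scope ring_scope.

(* The library density is supported on [0, +oo[ rather than ]0, +oo[; the two
   differ on a null set, so the law [exponential_prob rate] is the same. *)
Definition exponentially_distributed (R : realType) (d : measure_display)
    (T : measurableType d) (P : probability T R) (X : {RV P >-> R})
    (rate : R) : Prop :=
  forall A : set R, measurable A ->
    distribution P X A = exponential_prob rate A.

(* Main.v *)
Require Import Defs.
From HB Require Import structures.
From mathcomp Require Import all_boot all_order all_algebra.
From mathcomp Require Import all_classical all_reals all_analysis.
From mathcomp Require Import measurable_realfun ring lra.

Set Implicit Arguments.
Unset Strict Implicit.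
Unset Printing Implicit Defensive.

Import Order.TTheory GRing.Theory Num.Theory.
Import numFieldNormedType.Exports.

Local Open Scope classical_set_scope.
Local Open Scope ring_scope.

(** An exponential law of rate r has mean 1/r and variance 1/r^2, so it is the
law of a rate 1 variable rescaled by 1/r.  The event that it deviates from its
mean by at least y standard deviations is invariant under this rescaling, hence
its probability is the same for every rate, and the infimum is that of a
one-point set.  The event is the disjoint union of the half-lines
]-oo, (1 - y)/r] and [(1 + y)/r, +oo[.  The upper one has probability
exp(-(1 + y)); the lower one has probability 1 - exp(-(1 - y)) when y < 1 and
is null when y >= 1, because it then meets the support in at most one point.
Writing the latter as 1 - exp(- max(1 - y, 0)) covers both cases at once
([exponential_deviation]).

The mean, the variance and the tails all come from one integral,
[ge0_integral_quadratic_expRN]: the primitive of an exponential times a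
quadratic polynomial is of the same form and vanishes at infinity.
[ge0_integral_exponentially_distributed] turns expectations into such
integrals. *)

(** By uniqueness of the Radon-Nikodym derivative, [f] agrees almost everywhere
with the derivative of [nu] with respect to [mu], for which the change of
variables formula is known. *)
Lemma ge0_integral_density d (T : measurableType d) (R : realType)
    (nu : {finite_measure set T -> \bar R})
    (mu : {sigma_finite_measure set T -> \bar R}) (f g : T -> \bar R) :
  mu.-integrable [set: T] f ->
  (forall A, measurable A -> nu A = \int[mu]_(x in A) f x)%E ->
  measurable_fun [set: T] g -> (forall x, 0 <= g x)%E ->
  (\int[nu]_x g x = \int[mu]_x (g x * f x))%E.
Proof.
move=> intf nuE mg g0.
have mf := measurable_int _ intf.
have numu : nu `<< mu.
  apply/null_content_dominatesP => A mA A0; rewrite nuE// null_set_integral//.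
  exact: measurable_funTS.
rewrite -(Radon_Nikodym_SigmaFinite.change_of_variables numu)//.
have ih := Radon_Nikodym_SigmaFinite.f_integrable numu.
have mh := measurable_int _ ih.
apply: ae_eq_integral => //; [exact: emeasurable_funM..|].
apply: ae_eqe_mul2l; apply: integral_ae_eq => // A _ mA.
by rewrite -Radon_Nikodym_SigmaFinite.f_integral// nuE.
Qed.

Section exponential.
Context (R : realType) (rate : R) (rate0 : 0 < rate).
Notation mu := (@lebesgue_measure R).

(** On [1, +oo[ the polynomial is at most a constant times x^2, while the cubic
term of the exponential series gives exp(rate * x) >= (rate * x)^3 / 6; the
product is therefore O(1/x). *)
Lemma cvgy_quadratic_expRN (a b c : R) :
  (a * x ^+ 2 + b * x + c) * expR (- rate * x) @[x --> +oo] --> 0.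
Proof.
pose K := (`|a| + `|b| + `|c|) * (6 / rate ^+ 3).
have K0 : K * x^-1 @[x --> +oo] --> 0.
  rewrite -(mulr0 K); apply: cvgM; first exact: cvg_cst.
  apply/gtr0_cvgV0; [exact: nbhs_pinfty_gt|exact: cvg_id].
have KN0 : - (K * x^-1) @[x --> +oo] --> 0 by rewrite -oppr0; apply: cvgN.
apply: (squeeze_cvgr _ KN0 K0); near=> x.
have x1 : 1 <= x by near: x; exact: nbhs_pinfty_ge.
have x0 : 0 < x by exact: lt_le_trans x1.
rewrite -ler_norml normrM (ger0_norm (expR_ge0 _)) mulNr expRN.
have qx : `|a * x ^+ 2 + b * x + c| <= (`|a| + `|b| + `|c|) * x ^+ 2.
  rewrite !mulrDl (le_trans (ler_normD _ _))// lerD//.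
    rewrite (le_trans (ler_normD _ _))// lerD// normrM.
      by rewrite (ger0_norm (sqr_ge0 _)).
    by rewrite ler_wpM2l// (ger0_norm (ltW x0)); nra.
  by rewrite ler_peMr//; nra.
have ex : (expR (rate * x))^-1 <= 6 / (rate ^+ 3 * x ^+ 3).
  rewrite -[leRHS]invrK lef_pV2 ?posrE ?expR_gt0 ?invr_gt0 ?divr_gt0//.
    rewrite invf_div -exprMn.
    apply: le_trans (expR_ge1Dxn 2 _); last by rewrite mulr_ge0// ltW.
    by rewrite lerDr.
  by rewrite mulr_gt0// exprn_gt0.
have e0 : 0 <= (expR (rate * x))^-1 by rewrite invr_ge0 expR_ge0.
apply: (le_trans (ler_pM (normr_ge0 _) e0 qx ex)).
rewrite le_eqVlt; apply/orP; left; apply/eqP; rewrite /K; field.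
by rewrite !gt_eqF.
Unshelve. all: by end_near. Qed.

Lemma is_derive_quadratic_expRN (a b c x : R) :
  is_derive x 1 (fun x => - ((a * x ^+ 2 + b * x + c) * expR (- rate * x)))
  ((rate * (a * x ^+ 2 + b * x + c) - (2 * a * x + b)) * expR (- rate * x)).
Proof.
by apply: is_derive_eq; rewrite /GRing.scale/=; ring.
Qed.

(** The integrand is written as [rate * q - q^`()] with [q] the quadratic
polynomial [a x^2 + b x + c], so that [- q * exp(- rate * x)] is a primitive.
Tails, mean and variance of the exponential law correspond to the choices
[q = 1], [q = x + 1/rate] and [q = x^2 + 1/rate^2]. *)
Lemma ge0_integral_quadratic_expRN (a b c t : R) :
  (forall x, t <= x ->
    0 <= rate * (a * x ^+ 2 + b * x + c) - (2 * a * x + b)) ->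
  (\int[mu]_(x in `[t, +oo[) ((rate * (a * x ^+ 2 + b * x + c)
      - (2 * a * x + b)) * expR (- rate * x))%:E
  = ((a * t ^+ 2 + b * t + c) * expR (- rate * t))%:E)%E.
Proof.
move=> f0.
pose F := fun x => - ((a * x ^+ 2 + b * x + c) * expR (- rate * x)).
rewrite (@ge0_continuous_FTC2y _ _ F _ 0).
- by rewrite sub0e -EFinN opprK.
- by move=> x tx; rewrite mulr_ge0 ?f0 ?expR_ge0.
- apply: continuous_subspaceT => x.
  apply: differentiable_continuous; apply/derivable1_diffP.
  exact: ex_derive.
- by rewrite -oppr0; apply: cvgN; exact: cvgy_quadratic_expRN.
- by move=> x _; have [] := is_derive_quadratic_expRN a b c x.
- apply: cvg_at_right_filter.
  have [dF _] := is_derive_quadratic_expRN a b c t.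
  by apply: differentiable_continuous; exact/derivable1_diffP.
- move=> x _; rewrite derive1E.
  by have [_ ->] := is_derive_quadratic_expRN a b c x.
Qed.

Lemma exponential_prob_itvcy (t : R) : 0 <= t ->
  exponential_prob rate `[t, +oo[ = (expR (- rate * t))%:E.
Proof.
move=> t0; rewrite /exponential_prob.
have := @ge0_integral_quadratic_expRN 0 0 1 t.
rewrite !mul0r !add0r mul1r => <-; last first.
  by move=> x _; rewrite !(mul0r, mulr0, add0r, subr0) mulr1 ltW.
apply: eq_integral => x; rewrite inE/= in_itv/= andbT => tx.
rewrite exponential_pdfE ?(le_trans t0 tx)//.
by rewrite !(mul0r, mulr0, add0r, subr0) mulr1.
Qed.

Lemma exponential_prob_itvoy (t : R) : 0 <= t ->
  exponential_prob rate `]t, +oo[ = (expR (- rate * t))%:E.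
Proof.
move=> t0; rewrite -exponential_prob_itvcy// /exponential_prob.
rewrite integral_itv_obnd_cbnd//; apply/measurable_EFinP.
by apply: measurable_funTS; exact: measurable_exponential_pdf.
Qed.

Lemma exponential_prob_lt0 (A : set R) : A `<=` `]-oo, 0%R[ ->
  exponential_prob rate A = 0%E.
Proof.
move=> A0; apply: integral0_eq => x /A0; rewrite /= in_itv/= => x0.
by rewrite lt0_exponential_pdf.
Qed.

Section random_variable.
Context d (T : measurableType d) (P : probability T R) (X : {RV P >-> R}).
Hypothesis hX : exponentially_distributed X rate.

(** The density of the law vanishes on the negative half-line, which restricts
the integral to [0, +oo[. *)
Lemma ge0_integral_exponentially_distributed (g : R -> R) :
  measurable_fun [set: R] g -> (forall x, 0 <= g x) ->
  (\int[P]_w (g (X w))%:E =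
   \int[mu]_(x in `[0%R, +oo[) (g x * (rate * expR (- rate * x)))%:E)%E.
Proof.
move=> mg g0.
(* Lebesgue measure lives on the copy [measurableTypeR R] of the reals, which
   has the same measurable sets but another display; [Y] is [X] with values in
   that copy. *)
have mX : measurable_fun [set: T] (X : T -> measurableTypeR R).
  by move=> _ A mA; exact: (measurable_funPT X).
pose Y : {mfun T >-> measurableTypeR R} :=
  @mfun_Sub _ _ T (measurableTypeR R) X (mem_set mX).
have mEg : measurable_fun [set: measurableTypeR R] (EFin \o g).
  exact/measurable_EFinP.
rewrite -[LHS](@ge0_integral_distribution _ _ _ _ _ P Y (EFin \o g))//.
rewrite (@ge0_integral_density _ _ _ (distribution P Y) mu
  (EFin \o exponential_pdf rate))//; last exact: integrable_exponential_pdf.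
rewrite [RHS]integral_mkcond; apply: eq_integral => x _ /=.
rewrite patchE /exponential_pdf patchE; case: ifPn => // _.
exact: mule0.
Qed.

(** [X] may take negative values, but only on a null set: its expectation is
that of its absolute value, to which the formula for nonnegative integrands
applies. *)
Lemma expectation_exponential : ('E_P[X] = (rate^-1)%:E)%E.
Proof.
rewrite expectation.unlock.
transitivity (\int[P]_w `|X w|%:E)%E.
  apply: ae_eq_integral => //.
  - exact/measurable_EFinP.
  - by apply/measurable_EFinP; exact: measurableT_comp.
  exists (X @^-1` `]-oo, 0[); split.
  - by rewrite -[X in measurable X]setTI; exact: measurable_funP.
  - transitivity (distribution P X `]-oo, 0[) => //.
    by rewrite hX// exponential_prob_lt0.
  - move=> w /= nXw; rewrite in_itv/= ltNge; apply/negP => Xw0.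
    by apply: nXw => _; rewrite ger0_norm.
rewrite (ge0_integral_exponentially_distributed (g := Num.norm))//.
have qE x :
    rate * (0 * x ^+ 2 + 1 * x + rate^-1) - (2 * 0 * x + 1) = x * rate.
  by field; exact: lt0r_neq0.
have q0 : (0 * 0 ^+ 2 + 1 * 0 + rate^-1) * expR (- rate * 0) = rate^-1.
  by rewrite !(mulr0, mul0r, add0r) expR0 mulr1.
rewrite -[in RHS]q0 -ge0_integral_quadratic_expRN; last first.
  by move=> x x0; rewrite qE mulr_ge0// ltW.
apply: eq_integral => x; rewrite inE/= in_itv/= andbT => x0.
by rewrite qE ger0_norm// mulrA.
Qed.

Lemma variance_exponential : ('V_P[X] = (rate ^- 2)%:E)%E.
Proof.
rewrite /variance covariance.unlock expectation_exponential/=.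
rewrite expectation.unlock.
rewrite (ge0_integral_exponentially_distributed
  (g := fun x => (x - rate^-1) * (x - rate^-1)))//; last 2 first.
- by apply: measurable_funM; exact: measurable_funB.
- by move=> x; rewrite -expr2 sqr_ge0.
have qE x : rate * (1 * x ^+ 2 + 0 * x + rate ^- 2) - (2 * 1 * x + 0) =
    (x - rate^-1) * (x - rate^-1) * rate.
  by field; exact: lt0r_neq0.
have q0 : (1 * 0 ^+ 2 + 0 * 0 + rate ^- 2) * expR (- rate * 0) = rate ^- 2.
  by rewrite expr0n/= !(mulr0, add0r) expR0 mulr1.
rewrite -[in RHS]q0 -ge0_integral_quadratic_expRN; last first.
  by move=> x _; rewrite qE -expr2 mulr_ge0 ?sqr_ge0// ltW.
by apply: eq_integral => x _; rewrite qE mulrA.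
Qed.

Lemma exponential_cdf t : cdf X t = (1 - expR (- rate * Num.max t 0))%:E.
Proof.
have [t0|t0] := ltP t 0.
  rewrite /cdf mulr0 expR0 subrr hX// exponential_prob_lt0// => x/=.
  by rewrite !in_itv/= => /le_lt_trans; apply.
have ccdfE : ccdf X t = (expR (- rate * t))%:E.
  by rewrite /ccdf hX// exponential_prob_itvoy.
by rewrite EFinB -ccdfE -(cdf_ccdf_1 X t) addeK// ccdfE.
Qed.

Lemma exponential_deviation (y : R) : 0 < y ->
  P [set w | y * Num.sqrt (fine 'V_P[X]%E) <= `|X w - fine 'E_P[X]%E| ] =
  (1 - expR (- Num.max (1 - y) 0) + expR (- (1 + y)))%:E.
Proof.
move=> y0; rewrite variance_exponential expectation_exponential/=.
rewrite -exprVn sqrtr_sqr gtr0_norm ?invr_gt0//.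
transitivity (distribution P X
  (`]-oo, (1 - y) / rate] `|` `[(1 + y) / rate, +oo[)).
  congr (P _); apply/seteqP; split=> w/=; rewrite !in_itv/= andbT ler_normr.
    move=> /orP[]; [right|left]; lra.
  by move=> [h|h]; apply/orP; [right|left]; lra.
(* the rate cancels here, which is why it is absent from the final value *)
have rK z : - rate * (z / rate) = - z by field; exact: lt0r_neq0.
have lower_tail : distribution P X `]-oo, (1 - y) / rate] =
    (1 - expR (- Num.max (1 - y) 0))%:E.
  rewrite -[LHS]/(cdf X ((1 - y) / rate)) exponential_cdf.
  by rewrite -[in Num.max _ 0](mul0r rate^-1) -maxr_pMl ?invr_ge0 ?ltW// rK.
have upper_tail : distribution P X `[(1 + y) / rate, +oo[ =
    (expR (- (1 + y)))%:E.
  by rewrite hX// exponential_prob_itvcy ?rK// divr_ge0 ?ltW// addr_gt0.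
rewrite measureU//; last first.
  apply/seteqP; split=> // x [] /=; rewrite !in_itv/= andbT => x1 x2.
  have := le_trans x2 x1; rewrite ler_pM2r ?invr_gt0//; lra.
by rewrite EFinD; congr (_ + _)%E.
Qed.

End random_variable.

End exponential.

Theorem proposition2p2 (R : realType)
    (d : {posnum R} -> measure_display)
    (T : forall lambda : {posnum R}, measurableType (d lambda))
    (P : forall lambda : {posnum R}, probability (T lambda) R)
    (X : forall lambda : {posnum R}, {RV (P lambda) >-> R})
    (hX : forall lambda : {posnum R},
        exponentially_distributed (X lambda) lambda%:num)
    (y : R) (hy : 0 < y) :
  ereal_inf (range (fun lambda : {posnum R} =>
    P lambda [set w | y * Num.sqrt (fine 'V_(P lambda)[X lambda])
                      <= `|X lambda w - fine 'E_(P lambda)[X lambda]| ]))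
  = (if y < 1 then 1 - expR (- (1 - y)) + expR (- (1 + y))
     else expR (- (1 + y)))%:E.
Proof.
under eq_fun do rewrite (exponential_deviation _ (hX _) hy)//.
pose c := 1 - expR (- Num.max (1 - y) 0) + expR (- (1 + y)).
rewrite (_ : range _ = [set c%:E]); last first.
  by apply/seteqP; split => [_ [l _ <-]//|_ ->]; exists (1%:pos)%R.
rewrite ereal_inf1 /c; congr (_%:E).
have [y1|y1] := ltP y 1; first by rewrite max_l// subr_ge0 ltW.
by rewrite max_r ?subr_le0// oppr0 expR0 subrr add0r.
Qed.
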